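(* For every integer $d\ge 2$, the generalized degree polynomial $\mathbf{G}_T$ determines the matching-generating polynomial $M_{T_{(d)}}(t)$: if $T,T'$ are trees with $\mathbf{G}_T=\mathbf{G}_{T'}$, then $M_{T_{(d)}}(t)=M_{T'_{(d)}}(t)$.
   Context: All graphs are finite and simple. For a tree $T$ and $A\subseteq V(T)$, $e(A)$ is the number of edges of $T$ with both endpoints in $A$ and $d(A)$ the number with exactly one endpoint in $A$; $\mathbf{G}_T(x,y,z)=\sum_{A\subseteq V(T)} x^{|A|}y^{d(A)}z^{e(A)}$. For a graph $G$, the matching-generating polynomial is $M_G(t)=\sum_S t^{|S|}$ over all matchings $S$ (sets of pairwise disjoint edges) of $G$. $T_{(d)}$ denotes the induced subgraph of $T$ on the set of vertices of degree $d$ in $T$. *)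

(* Defs.v *)
From mathcomp Require Import all_boot all_order all_algebra.
From mathcomp Require Import mpoly.

Set Implicit Arguments.
Unset Strict Implicit.
Unset Printing Implicit Defensive.

Import GRing.Theory.
Local Open Scope ring_scope.

Record sgraph := SGraph {
  vertex :> finType;
  adj : rel vertex;
  adj_sym : ssrbool.symmetric adj;
  adj_irrefl : irreflexive adj
}.

(* [ucycle] is a cyclic list of distinct vertices, and also accepts lists of
   length 1 or 2: a graph cycle needs at least three vertices. *)
Definition acyclic (G : sgraph) : Prop :=
  forall c : seq G, (2 < size c)%N -> ~ ucycle (@adj G) c.

Definition is_tree (G : sgraph) : Prop :=
  [/\ (0 < #|G|)%N, forall x y : G, connect (@adj G) x y & acyclic G].

(* An edge is the unordered pair of its endpoints. *)
Definition edges (G : sgraph) : {set {set G}} :=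
  [set [set p.1; p.2] | p : G * G & adj p.1 p.2].

Definition degree (G : sgraph) (x : G) : nat := #|[set y | adj x y]|.

Definition edges_in (G : sgraph) (A : {set G}) : nat :=
  #|[set E in edges G | E \subset A]|.

Definition edges_out (G : sgraph) (A : {set G}) : nat :=
  #|[set E in edges G | #|E :&: A| == 1%N]|.

(* The variables x, y, z are 'X_0, 'X_1, 'X_2. *)
Definition gen_degree_poly (G : sgraph) : {mpoly int[3]} :=
  \sum_(A : {set G})
    'X_(inord 0) ^+ #|A| * 'X_(inord 1) ^+ edges_out A
      * 'X_(inord 2) ^+ edges_in A.

Section Induced.
Variables (G : sgraph) (P : pred G).

Definition induced_adj : rel {x : G | P x} := fun x y => adj (val x) (val y).

Lemma induced_adj_sym : ssrbool.symmetric induced_adj.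
Proof. by move=> x y; apply: adj_sym. Qed.

Lemma induced_adj_irrefl : irreflexive induced_adj.
Proof. by move=> x; apply: adj_irrefl. Qed.

Definition induced : sgraph := SGraph induced_adj_sym induced_adj_irrefl.

End Induced.

Definition degree_subgraph (G : sgraph) (d : nat) : sgraph :=
  induced [pred x : G | degree x == d].

Definition matching (G : sgraph) (S : {set {set G}}) : bool :=
  (S \subset edges G) && trivIset S.

Definition matching_poly (G : sgraph) : {poly int} :=
  \sum_(S : {set {set G}} | matching S) 'X^#|S|.

(* Main.v *)
(* Since d(A) + 2 e(A) is the sum over A of the degrees, the substitution
   z = y^2 (1 + u) turns G_T into the sum, over all edge sets F, of
     u^|F| * prod_(v in V(F)) w_v * prod_(v notin V(F)) (1 + w_v),
   where w_v = x y^(deg v).  Set y = 2 and x = (s - 1) / 2^d, so that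
   1 + w_v = s exactly when deg v = d, and u = t s^2.  If m is the number of
   vertices of degree d, the F-term has s-adic order at least
     2 |F| + m - |{v in V(F) : deg v = d}| >= m,
   with order exactly m iff F is a matching of T_(d).  The lowest coefficient
   in s is thus C * M_{T_(d)}(t) for a nonzero constant C, and C is recovered
   from M_{T_(d)}(0) = 1. *)

Require Import Defs.
From mathcomp Require Import all_boot all_order all_algebra.
From mathcomp Require Import mpoly ring zify.

Set Implicit Arguments.
Unset Strict Implicit.
Unset Printing Implicit Defensive.

Import GRing.Theory Num.Theory.
Local Open Scope ring_scope.

(** * Product expansions over subsets and supersets *)

Lemma expr1D_sum_subsets (R : comNzRingType) (I : finType) (S : {set I})
    (u : R) :
  (1 + u) ^+ #|S| = \sum_(F : {set I} | F \subset S) u ^+ #|F|.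
Proof.
transitivity (\prod_i ((if i \in S then u else 0) + 1)).
  rewrite -prodr_const big_mkcond; apply: eq_bigr => i _.
  by case: ifP; rewrite ?add0r // addrC.
rewrite bigA_distr [RHS]big_mkcond; apply: eq_bigr => F _.
case: ifPn => [/subsetP sFS | /subsetPn[i iF iS]]; last first.
  by rewrite (bigD1 i) //= iF (negPf iS) mul0r.
rewrite -prodr_const [RHS]big_mkcond; apply: eq_bigr => i _.
by case: ifP => // /sFS ->.
Qed.

(** Expand the product of [w i + [i \notin B]]: the zero summand at each [i] in [B] kills every [A]
    that omits it. *)
Lemma sum_prod_supersets (R : comNzRingType) (I : finType) (w : I -> R)
    (B : {set I}) :
  \sum_(A : {set I} | B \subset A) \prod_(i in A) w i =
    \prod_(i in B) w i * \prod_(i | i \notin B) (1 + w i).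
Proof.
transitivity (\prod_i (w i + (if i \in B then 0 else 1))).
  rewrite bigA_distr big_mkcond; apply: eq_bigr => A _.
  case: ifPn => [/subsetP sBA | /subsetPn[i iB iA]]; last first.
    by rewrite (bigD1 i) //= iB (negPf iA) mul0r.
  rewrite big_mkcond; apply: eq_bigr => i _; case: ifPn => // iA.
  by case: ifPn => // /sBA; rewrite (negPf iA).
rewrite (bigID (mem B)) /=; congr (_ * _); apply: eq_bigr => i iB.
  by rewrite iB addr0.
by rewrite (negPf iB) addrC.
Qed.

(** * Degree counting and the expansion over edge sets *)

Lemma in_edges2 (G : sgraph) (x y : G) : ([set x; y] \in edges G) = adj x y.
Proof.
apply/imsetP/idP => [[[a b]] | axy]; last by exists (x, y) => //; rewrite inE.
rewrite inE /= => aab /setP exy.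
have := exy x; have := exy y; have := exy b; have := exy a.
rewrite !inE !eqxx ?orbT /= => /orP[]/eqP ea /orP[]/eqP eb _ _.
- by move: aab; rewrite ea eb adj_irrefl.
- by rewrite -ea -eb.
- by rewrite -ea -eb adj_sym.
- by move: aab; rewrite ea eb adj_irrefl.
Qed.

Lemma edgesP (G : sgraph) (E : {set G}) :
  reflect (exists x y, adj x y /\ E = [set x; y]) (E \in edges G).
Proof.
apply: (iffP imsetP) => [[[x y]] | [x [y [axy ->]]]].
  by rewrite inE /= => axy ->; exists x, y.
by exists (x, y) => //; rewrite inE.
Qed.

Lemma adj_neq (G : sgraph) (x y : G) : adj x y -> x != y.
Proof. by apply: contraTneq => ->; rewrite adj_irrefl. Qed.

Lemma card_edge (G : sgraph) (E : {set G}) : E \in edges G -> #|E| = 2%N.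
Proof. by case/edgesP=> x [y [/adj_neq nxy ->]]; rewrite cards2 nxy. Qed.

Lemma degree_card_edges (G : sgraph) (x : G) :
  degree x = #|[set E in edges G | x \in E]|.
Proof.
rewrite /degree -(card_in_imset (f := fun y => [set x; y])); last first.
  move=> y z; rewrite !inE => /adj_neq nxy /adj_neq nxz /setP/(_ y).
  by rewrite !inE eqxx orbT eq_sym (negPf nxy) /= => /esym/eqP.
apply: eq_card => E; rewrite inE; apply/imsetP/andP => [[y]|[]].
  by rewrite inE => axy ->; rewrite in_edges2 !inE eqxx.
case/edgesP=> a [b [aab ->]]; rewrite !inE => /orP[]/eqP->.
  by exists b; rewrite ?inE.
by exists a; rewrite ?inE 1?adj_sym // setUC.
Qed.

(** Double counting of incidences: an edge [E] is counted [#|E :&: A|] times, which is 0, 1 or 2. *)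
Lemma sum_degree (G : sgraph) (A : {set G}) :
  (\sum_(v in A) degree v = edges_out A + 2 * edges_in A)%N.
Proof.
transitivity (\sum_(E in edges G) #|E :&: A|)%N.
  under eq_bigr => v _ do rewrite degree_card_edges -sum1_card big_mkcond.
  rewrite exchange_big [RHS]big_mkcond; apply: eq_bigr => E _ /=.
  case: (boolP (E \in edges G)) => EG; last first.
    by rewrite big1 // => v _; rewrite inE (negPf EG).
  rewrite -sum1_card -big_mkcondr; apply: eq_bigl => v.
  by rewrite !inE EG andbC.
rewrite /edges_out /edges_in -!sum1_card big_distrr /=.
rewrite [X in (_ = X + _)%N]big_mkcond [X in (_ = _ + X)%N]big_mkcond.
rewrite -big_split /= big_mkcond; apply: eq_bigr => E _.
rewrite !inE; case: ifP => //= EG; have cE := card_edge EG.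
case: (boolP (E \subset A)) => [/setIidPl -> | sEA]; first by rewrite cE.
have : (#|E :&: A| < 2)%N.
  by rewrite -cE proper_card // properE subsetIl subsetI subxx.
by case: #|E :&: A| => [|[|]].
Qed.

(** By [sum_degree] the powers of [y] combine into a product over [A], and the powers of [1 + u]
    expand over the sets [F] of edges inside [A]. After exchanging the sums, [A] runs over the
    supersets of [cover F]. *)
Lemma sum_edge_subsets (R : comNzRingType) (G : sgraph) (x y u : R) :
  \sum_(A : {set G})
     x ^+ #|A| * y ^+ edges_out A * (y ^+ 2 * (1 + u)) ^+ edges_in A =
  \sum_(F : {set {set G}} | F \subset edges G)
     u ^+ #|F| * (\prod_(v in cover F) (x * y ^+ degree v)
                * \prod_(v | v \notin cover F) (1 + x * y ^+ degree v)).
Proof.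
under eq_bigr => A _.
  rewrite exprMn mulrA -(mulrA (x ^+ _)) -exprM -exprD -sum_degree.
  rewrite -prodr_const expr_sum -big_split expr1D_sum_subsets big_distrr /=.
over.
rewrite (exchange_big_dep (fun F : {set {set G}} => F \subset edges G)) /=;
  last first.
  move=> A F _ /subset_trans; apply; apply/subsetP=> E.
  by rewrite inE => /andP[].
apply: eq_bigr => F sF; rewrite -sum_prod_supersets big_distrr /=.
apply: eq_big => [A | A _]; last by rewrite mulrC.
apply/subsetP/bigcupsP => [h E EF | h E EF].
  by have := h E EF; rewrite inE => /andP[].
by rewrite inE (subsetP sF) ?h.
Qed.

(** * Matchings of an induced subgraph *)

Lemma imset_edge_induced (G : sgraph) (P : pred G) (E : {set induced P}) :
  (val @: E \in edges G) = (E \in edges (induced P)).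
Proof.
apply/edgesP/edgesP => [[x [y [axy Exy]]] | [x [y [axy ->]]]]; last first.
  by exists (val x), (val y); rewrite imsetU !imset_set1.
have /imsetP[u _ xu] : x \in val @: E by rewrite Exy !inE eqxx.
have /imsetP[v _ yv] : y \in val @: E by rewrite Exy !inE eqxx orbT.
exists u, v; split; first by rewrite /= /induced_adj -xu -yv.
by apply: (imset_inj val_inj); rewrite Exy imsetU !imset_set1 xu yv.
Qed.

(** Transports matchings along the inclusion [val], so that they can be compared term by term with
    edge sets of [G]. Preimage inverts the transport exactly on families covered by [P]. *)
Lemma matching_poly_induced (G : sgraph) (P : pred G) :
  matching_poly (induced P) =
    \sum_(F : {set {set G}} | matching F && (cover F \subset P)) 'X^#|F|.
Proof.
have imI := imset_inj (@val_inj _ _ {x : G | P x}).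
pose phi (S : {set {set induced P}}) := [set val @: (E : {set _}) | E in S].
pose psi (F : {set {set G}}) : {set {set induced P}} :=
  [set val @^-1: (E : {set G}) | E in F].
have valK (E : {set induced P}) : val @^-1: (val @: E) = E.
  by apply/setP=> x; rewrite inE mem_imset //; apply: val_inj.
rewrite (reindex_onto phi psi) => [|F /andP[_ /bigcupsP sFP]]; last first.
  rewrite /phi /psi -imset_comp -[RHS]imset_id; apply: eq_in_imset => E EF /=.
  apply/setP=> x; apply/imsetP/idP => [[y] | xE]; first by rewrite inE => ? ->.
  by exists (Sub x (subsetP (sFP E EF) x xE)); rewrite ?inE ?SubK.
apply: eq_big => [S | S _]; last by rewrite card_imset.
have -> : psi (phi S) = S.
  rewrite /psi /phi -imset_comp -[RHS]imset_id.
  by apply: eq_imset => E; apply: valK.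
rewrite eqxx andbT.
rewrite /matching imset_trivIset; last exact: val_inj.
have -> : cover [set val @: (E : {set _}) | E in S] \subset P.
  rewrite cover_imset; apply/bigcupsP=> E _; apply/subsetP=> _ /imsetP[x _ ->].
  exact: (valP x).
rewrite andbT; congr (_ && _); apply/subsetP/subsetP => h E.
  by case/imsetP=> E' E'S ->; rewrite imset_edge_induced h.
by move=> ES; rewrite -imset_edge_induced h //; apply: imset_f.
Qed.

Lemma matching_poly_horner0 (G : sgraph) : (matching_poly G).[0] = 1.
Proof.
rewrite /matching_poly horner_sum (bigD1 set0) /=; last first.
  by rewrite /matching sub0set /trivIset /cover !big_set0 cards0.
rewrite cards0 hornerXn big1 ?addr0 // => S /andP[_ nS].
by rewrite hornerXn expr0n cards_eq0 (negPf nS).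
Qed.

(** * Order in s of the vertex factor of an edge set *)

Section VertexProducts.

Context (K : comNzRingType) (I : finType) (c : I -> K) (D : {set I}).
Hypothesis cD : forall i, i \in D -> c i = 1.

(** The quotient by s^|D| of s^(2n) times the vertex factor, for n edges covering [B]. Vertices of
    [D] outside [B] supply one factor s each; the other [#|B :&: D|] come from s^(2n). The
    subtraction does not truncate when [#|B| <= 2 * n]. *)
Definition vertex_cofactor (B : {set I}) (n : nat) : {poly K} :=
  'X^(2 * n - #|B :&: D|) * \prod_(i in B) (('X - 1) * (c i)%:P)
    * \prod_(i | (i \notin B) && (i \notin D)) (1 + ('X - 1) * (c i)%:P).

Lemma vertex_cofactorE (B : {set I}) (n : nat) : (#|B| <= 2 * n)%N ->
  'X^(2 * n) * (\prod_(i in B) (('X - 1) * (c i)%:P)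
      * \prod_(i | i \notin B) (1 + ('X - 1) * (c i)%:P)) =
    'X^#|D| * vertex_cofactor B n.
Proof.
move=> leBn; have leBDn : (#|B :&: D| <= 2 * n)%N.
  by apply: leq_trans leBn; rewrite subset_leq_card ?subsetIl.
rewrite (bigID (mem D) (fun i => i \notin B)) /=.
rewrite [X in _ * (_ * (X * _))](_ : _ = 'X^#|D :\: B|); last first.
  rewrite -prodr_const; apply: eq_big => [i | i /andP[_ /cD->]].
    by rewrite inE.
  by rewrite polyC1 mulr1 addrC subrK.
rewrite /vertex_cofactor !mulrA; congr (_ * _).
rewrite mulrAC -!exprD; congr ('X^_ * _).
by rewrite -(cardsID B D) setIC; lia.
Qed.

(** The power of s vanishes at 0 unless [#|B :&: D|] reaches 2n, which forces [B] into [D] with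
    exactly 2n elements. *)
Lemma vertex_cofactor0 (B : {set I}) (n : nat) : (#|B| <= 2 * n)%N ->
  (vertex_cofactor B n).[0] =
    if (B \subset D) && (#|B| == 2 * n)%N then \prod_(i | i \notin D) (1 - c i)
    else 0.
Proof.
move=> leBn; rewrite !hornerM hornerXn !horner_prod.
case: ifPn => [/andP[/[dup] sBD /setIidPl-> /eqP eBn] | nBD]; last first.
  rewrite expr0n subn_eq0 leqNgt (_ : (_ < _)%N) ?mul0r //.
  have := leBn; rewrite leq_eqVlt => /orP[/eqP eBn|]; last first.
    by apply: leq_ltn_trans; rewrite subset_leq_card ?subsetIl.
  rewrite -eBn proper_card // properE subsetIl subsetI subxx.
  by move: nBD; rewrite eBn eqxx andbT.
rewrite eBn subnn mul1r (eq_bigr (fun=> -1)); last first.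
  move=> i /(subsetP sBD)/cD->.
  by rewrite !hornerE; ring.
(* The 2n factors -1 from [B] cancel in pairs. *)
rewrite prodr_const eBn exprM sqrrN !expr1n mul1r.
apply: eq_big => [i | i _]; last by rewrite !hornerE; ring.
by case: (boolP (i \in B)) => // /(subsetP sBD) ->.
Qed.

End VertexProducts.

(** * Lowest coefficient in s of the specialized polynomial *)

(** Were the exponents different, the coefficient at the smaller one would be zero on one side only.
    Hence the two trees need not be known in advance to have equally many vertices of degree d. *)
Lemma Xn_mul_lowest_coef (R : nzRingType) (m n : nat) (p q : {poly R}) :
  'X^m * p = 'X^n * q -> p.[0] != 0 -> q.[0] != 0 -> p.[0] = q.[0].
Proof.
rewrite !horner_coef0 => pq p0 q0.
have := congr1 (fun r : {poly R} => r`_m) pq.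
have := congr1 (fun r : {poly R} => r`_n) pq.
rewrite !coefXnM !ltnn !subnn; case: ltngtP => [_ e|_ _ e|->]; last by rewrite subnn.
  by rewrite -e eqxx in q0.
by rewrite e eqxx in p0.
Qed.

(* The values of x, y, z in Q[t][s]: s is the outer and t the inner variable. *)
Definition pole_point (d : nat) (i : 'I_3) : {poly {poly rat}} :=
  [tuple ('X - 1) * (2 ^- d)%:P%:P;
         2%:P%:P;
         2%:P%:P ^+ 2 * (1 + 'X%:P * 'X^2)]`_i.

(** The product of the factors 1 + w_v at s = 0 over the vertices of degree other than d. *)
Definition pole_constant (G : sgraph) (d : nat) : rat :=
  \prod_(v : G | degree v != d) (1 - 2 ^- d * 2 ^+ degree v).

Lemma pole_constant_neq0 (G : sgraph) (d : nat) : pole_constant G d != 0.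
Proof.
apply/prodf_neq0 => v nd; rewrite subr_eq0.
apply: contra nd => /eqP /(congr1 ( *%R (2 ^+ d))).
rewrite mulr1 mulrA mulfV ?expf_neq0 // mul1r => /eqP.
by rewrite -!natrX eqr_nat eqn_exp2l // eq_sym.
Qed.

Lemma gen_degree_poly_at_pole (G : sgraph) (d : nat) :
  exists q : {poly {poly rat}},
    mmap intr (pole_point d) (gen_degree_poly G) =
      'X^#|[set v : G | degree v == d]| * q
    /\ q.[0] = (pole_constant G d)%:P
               * map_poly intr (matching_poly (degree_subgraph G d)).
Proof.
set D := [set v : G | _].
pose c (v : G) : {poly rat} := (2 ^- d * 2 ^+ degree v)%:P.
have cD v : v \in D -> c v = 1.
  by rewrite inE => /eqP dv; rewrite /c dv mulVf ?expf_neq0.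
pose q (F : {set {set G}}) := 'X^#|F|%:P * vertex_cofactor c D (cover F) #|F|.
(* The bound gives the order in s; its equality case singles out the matchings. *)
have leF (F : {set {set G}}) : F \subset edges G ->
    (#|cover F| <= 2 * #|F| ?= iff trivIset F)%N.
  move=> sF; rewrite [(2 * _)%N](_ : _ = \sum_(E in F) #|E|)%N.
    exact: leq_card_cover.
  rewrite mulnC -sum_nat_const; apply: eq_bigr => E EF.
  by rewrite card_edge ?(subsetP sF).
exists (\sum_(F : {set {set G}} | F \subset edges G) q F); split.
  rewrite /gen_degree_poly rmorph_sum /=.
  under eq_bigr => A _.
    rewrite !rmorphM !rmorphXn /= !mmapX !mmap1U /pole_point !inordK //=.
  over.
  rewrite sum_edge_subsets big_distrr /=; apply: eq_bigr => F sF.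
  rewrite /q [RHS]mulrCA -(vertex_cofactorE cD) ?(leF F sF) //.
  rewrite exprMn -exprM -rmorphXn -mulrA; congr (_ * (_ * (_ * _)));
    by apply: eq_bigr => v _; rewrite /c !polyCM !polyC_exp mulrA.
rewrite /degree_subgraph matching_poly_induced rmorph_sum /= big_distrr horner_sum /=.
rewrite big_mkcond [RHS]big_mkcond; apply: eq_bigr => F _ /=.
rewrite /matching; case: ifP => //= sF.
rewrite /q hornerM hornerC (vertex_cofactor0 cD) ?(leF F sF) //.
have -> : (cover F \subset D) = (cover F \subset [pred x : G | degree x == d]).
  by apply: eq_subset_r => v; rewrite !inE.
rewrite andbC; case: ifP => _; last by rewrite mulr0.
rewrite map_polyXn mulrC; congr (_ * _).
rewrite /pole_constant rmorph_prod; apply: eq_big => [v|v _].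
  by rewrite inE.
by rewrite rmorphB rmorph1.
Qed.

Local Close Scope ring_scope.

Theorem theorem4p6 (d : nat) (hd : 2 <= d) (T T' : sgraph)
    (hT : is_tree T) (hT' : is_tree T')
    (hG : gen_degree_poly T = gen_degree_poly T') :
  matching_poly (degree_subgraph T d) = matching_poly (degree_subgraph T' d).
Proof.
have [q [Eq q0]] := gen_degree_poly_at_pole T d.
have [q' [Eq' q0']] := gen_degree_poly_at_pole T' d.
pose at0 (G : sgraph) :=
  ((pole_constant G d)%:P
     * map_poly intr (matching_poly (degree_subgraph G d)))%R.
(* Here the evaluation is at t = 0, where the matching polynomial is 1. *)
have at00 (G : sgraph) : ((at0 G).[0] = pole_constant G d)%R.
  rewrite hornerM hornerC -(rmorph0 intr) horner_map matching_poly_horner0.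
  by rewrite rmorph1 mulr1.
have at0_neq0 (G : sgraph) : (at0 G != 0)%R.
  apply: contraNneq (pole_constant_neq0 G d) => e.
  by rewrite -at00 e horner0.
have e : at0 T = at0 T'.
  (* Two factorizations of one specialized polynomial: compare their lowest coefficients in s. *)
  rewrite hG Eq' in Eq.
  have := Xn_mul_lowest_coef (esym Eq).
  by rewrite q0 q0'; apply; apply: at0_neq0.
have ec : pole_constant T d = pole_constant T' d by rewrite -!at00 e.
(* The factor [2 ^- d] required rational coefficients; injectivity of [intr] returns to the
   integers. *)
apply: (@map_inj_poly _ _ (intr : int -> rat)) => //.
  by move=> x y /eqP; rewrite eqr_int => /eqP.
apply: (mulfI (x := (pole_constant T d)%:P%R)).
  by rewrite polyC_eq0 pole_constant_neq0.
by rewrite {2}ec; exact: e.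
Qed.
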